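(* $\Diamond^*$ implies that there exists a forcing poset which is Knaster but not stationarily Knaster.
   Context: $\Diamond^*$ is the statement that there exists a sequence $\langle \mathcal{S}_\alpha : \alpha < \omega_1\rangle$ such that (1) each $\mathcal{S}_\alpha$ is a collection of countably many subsets of $\alpha$, and (2) for all $X \subseteq \omega_1$ there is a club $D \subseteq \omega_1$ such that for all $\alpha \in D$, $X \cap \alpha \in \mathcal{S}_\alpha$. A subset of a forcing poset is linked if any two of its members are compatible (have a common lower bound). A forcing poset $\mathbb{P}$ is Knaster if for every family $\{p_i : i < \omega_1\}$ of conditions there is an uncountable $X \subseteq \omega_1$ such that $\{p_i : i \in X\}$ is linked. It is stationarily Knaster if for every family $\{p_i : i \in S\}$ of conditions, where $S \subseteq \omega_1$ is stationary, there is a stationary set $T \subseteq S$ such that $\{p_i : i \in T\}$ is linked. *)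

(* Defs.v *)
From HB Require Import structures.
From mathcomp Require Import all_boot all_order.
From mathcomp Require Import mathcomp_extra boolp classical_sets functions.
From mathcomp Require Import cardinality wochoice.

Set Implicit Arguments.
Unset Strict Implicit.
Unset Printing Implicit Defensive.

Import Order.TTheory.

Local Open Scope classical_set_scope.
Local Open Scope order_scope.

(* The ordinal a itself in the von Neumann reading. *)
Definition segment (d : Order.disp_t) (W : orderType d) (a : W) : set W :=
  [set b | b < a].

(* The first uncountable ordinal, up to order isomorphism: an uncountable
   well-order all of whose proper initial segments are countable. *)
Definition is_omega1 (d : Order.disp_t) (W : orderType d) : Prop :=
  [/\ forall A : set W, A !=set0 -> exists2 m : W, A m & lbound A m,
      ~ countable [set: W] &
      forall a : W, countable (segment a)].

Section Omega1.
Context (d : Order.disp_t) (W : orderType d).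

Definition unbounded (C : set W) : Prop :=
  forall a : W, exists2 c : W, C c & a < c.

(* Under these hypotheses [a] is automatically a nonzero limit point: it is not
   the least element, and the elements of [C] are cofinal in it from below. *)
Definition omega1_closed (C : set W) : Prop :=
  forall a : W, segment a !=set0 ->
    (forall b : W, b < a -> exists2 c : W, C c & b < c < a) -> C a.

Definition club (C : set W) : Prop := omega1_closed C /\ unbounded C.

Definition stationary (S : set W) : Prop :=
  forall C : set W, club C -> S `&` C !=set0.

Definition diamond_star : Prop :=
  exists Sseq : W -> set (set W),
    (forall a : W, countable (Sseq a) /\
       (forall A : set W, Sseq a A -> A `<=` segment a)) /\
    (forall X : set W, exists2 D : set W, club D &
       forall a : W, D a -> Sseq a (X `&` segment a)).

End Omega1.

Section Posets.
Context (e : Order.disp_t) (P : porderType e).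

Definition compatible (p q : P) : Prop := exists r : P, r <= p /\ r <= q.

Definition linked (L : set P) : Prop :=
  forall p q : P, L p -> L q -> compatible p q.

(* [W] is the index set, meant to be omega_1. *)
Definition Knaster (d : Order.disp_t) (W : orderType d) : Prop :=
  forall p : W -> P, exists2 X : set W, ~ countable X & linked (p @` X).

(* A family indexed by [S] is given by a total function, of which only the
   values on [S] matter. *)
Definition stationarily_Knaster (d : Order.disp_t) (W : orderType d) : Prop :=
  forall (S : set W) (p : W -> P), stationary S ->
    exists T : set W, [/\ T `<=` S, stationary T & linked (p @` T)].

End Posets.

(* Such well-orders exist: in a well-order of [set nat], take the points with
   countably many predecessors. *)
Section Omega1Exists.

Let T := set nat.
Let R : rel T := sval (well_ordering_principle T).
Let Rwo : wochoice.well_order R := svalP (well_ordering_principle T).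
Let small : pred T := fun x => `[< countable [set y | R y x] >].

Let carrier := {x : T | small x}.
Let le (x y : carrier) := R (val x) (val y).

Let Rtot : total R.
Proof.
move=> x y; have [|z [[zxy zlb] _]] := Rwo (A := [pred u | (u == x) || (u == y)]).
  by exists x; rewrite inE eqxx.
move: zxy; rewrite inE => /orP[]/eqP zE.
  by rewrite -{1}zE zlb // inE eqxx orbT.
by rewrite -{2}zE [R z x]zlb ?orbT // inE eqxx.
Qed.

Let Ranti : antisymmetric R.
Proof.
move=> x y /andP[xy yx].
have Rrefl u : R u u by have := Rtot u u; rewrite orbb.
have [|z [_ zU]] := Rwo (A := [pred u | (u == x) || (u == y)]).
  by exists x; rewrite inE eqxx.
have zx : z = x.
  by apply: zU; split=> [|u]; rewrite inE ?eqxx // => /orP[]/eqP ->.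
have zy : z = y.
  by apply: zU; split=> [|u]; rewrite inE ?eqxx ?orbT // => /orP[]/eqP ->.
by rewrite -zx -zy.
Qed.

Let Rtrans : transitive R.
Proof.
move=> y x z xy yz.
have [|m [[mxyz mlb] _]] := Rwo (A := [pred u | [|| u == x, u == y | u == z]]).
  by exists x; rewrite inE eqxx.
move: mxyz; rewrite inE => /or3P[]/eqP mE.
- by rewrite -mE mlb // inE eqxx !orbT.
- have yx : R y x by rewrite -mE mlb // inE eqxx.
  by rewrite (Ranti (x := x) (y := y)) ?xy.
- have zy : R z y by rewrite -mE mlb // inE eqxx orbT.
  by rewrite (Ranti (x := z) (y := y)) ?zy.
Qed.

Let le_anti : antisymmetric le.
Proof. by move=> x y /Ranti/val_inj. Qed.
Let le_trans : transitive le.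
Proof. by move=> y x z; exact: Rtrans. Qed.
Let le_total : total le.
Proof. by move=> x y; exact: Rtot. Qed.

Definition omega1_model : Type := carrier.
HB.instance Definition _ := Choice.on omega1_model.
HB.instance Definition _ :=
  Order.isOrder.Build Order.default_display omega1_model
    (fun _ _ => erefl) (fun _ _ => erefl) (fun _ _ => erefl)
    le_anti le_trans le_total.

Lemma omega1_model_is_omega1 : is_omega1 omega1_model.
Proof.
have leE (x y : omega1_model) : (x <= y) = R (val x) (val y) by [].
split.
- move=> A [x0 Ax0].
  have [|m [[/asboolP[x Ax <-] mlb] _]] :=
      Rwo (A := fun z => `[< exists2 x, A x & val x = z >]).
    by exists (val x0); apply/asboolP; exists x0.
  exists x => // y Ay; rewrite leE; apply: mlb.
  by apply/asboolP; exists y.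
- move=> /countable_injP[f finj].
  have small_countable : countable [set y | small y].
    apply/countable_injP.
    exists (fun y => if insub y is Some u then f u else 0%N) => x y.
    rewrite !inE => sx sy; rewrite (insubT small sx) (insubT small sy).
    by move=> /finj; rewrite !inE => /(_ I I)/(congr1 val).
  have [z zlarge] : exists z, ~~ small z.
    apply: contrapT => all_small.
    have /countable_injP[g ginj] : countable [set: T].
      apply: sub_countable small_countable; apply: subset_card_le => y _ /=.
      by apply: contrapT => /negP ylarge; apply: all_small; exists y.
    pose D : T := [set n | exists2 A : T, g A = n & ~ A n].
    have nD : ~ D (g D).
      by move=> DD; case: (DD) => A /ginj; rewrite !inE => /(_ I I) -> /(_ DD).
    by apply: (nD); exists D.
  have [|m [[mlarge mlb] _]] := Rwo (A := fun z => ~~ small z).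
    by exists z.
  move/negP: mlarge; apply; apply/asboolP.
  have /countable_injP[h hinj] := small_countable.
  have below y : R y m -> ~~ small y -> y = m.
    by move=> ym yl; apply: Ranti; rewrite ym mlb.
  apply/countable_injP.
  exists (fun y => if small y then (h y).+1 else 0%N) => x y.
  rewrite !inE /= => xm ym.
  have [xs|xl] := boolP (small x); have [ys|yl] := boolP (small y) => //.
    by case=> /hinj; rewrite !inE; apply.
  by rewrite (below x) // (below y).
- move=> x; have /asboolP/countable_injP[f finj] := valP x.
  apply/countable_injP; exists (f \o val) => y z.
  rewrite !inE /segment /= => /ltW yx /ltW zx /finj.
  by rewrite !inE => /(_ yx zx)/val_inj.
Qed.

End Omega1Exists.

Lemma omega1_exists :
  exists (d : Order.disp_t) (W : orderType d), is_omega1 W.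
Proof.
by exists Order.default_display, omega1_model; exact: omega1_model_is_omega1.
Qed.

(* Main.v *)
Require Import Defs.
From HB Require Import structures.
From mathcomp Require Import all_boot all_order.
From mathcomp Require Import boolp classical_sets.
From mathcomp Require Import mathcomp_extra functions cardinality finmap.

(** Call a finite set of countable ordinals free if it contains no [x], [y]
    with [x \in C y], where [C y] is a subset of [y] finite below each
    [z < y].  By diamond-star, [C y] can be chosen to meet every set guessed at
    [y] that is cofinal in [y]; a stationary set [T] then contains some
    [x \in C y] with [y \in T], so the singletons of [T] are not linked.  The
    free sets are Knaster nevertheless: reindex the family by [h] so that [a] is
    not in [p (h a)] and [a <= h a].  The points of [p (h a)] above [a] then
    lie strictly above [a], so their ladders meet [a] in a finite set.  Pressing
    down makes this finite set and [p (h a)] below [a] bounded by a fixed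
    ordinal, and [p (h a)] below [a] constant, on an uncountable set. *)

Set Implicit Arguments.
Unset Strict Implicit.
Unset Printing Implicit Defensive.

Import Order.TTheory.

Local Open Scope classical_set_scope.
Local Open Scope order_scope.

(** * Finite and countable sets *)

Lemma finite_lt_bound (d : Order.disp_t) (W : orderType d) (F : set W) (c a : W) :
  finite_set F -> c < a -> F `<=` segment a ->
  exists2 b, b < a & forall x, F x -> x <= b.
Proof.
move=> /finite_seqP[s ->] ca; elim: s => [|x s IHs] sa; first by exists c.
have [|b ba bub] := IHs.
  by move=> y /= ys; apply: sa; rewrite /= inE ys orbT.
exists (Order.max x b).
  by rewrite gt_max ba andbT; apply: sa; rewrite /= inE eqxx.
move=> y /=; rewrite inE le_max => /orP[/eqP->|/bub->]; first by rewrite lexx.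
by rewrite orbT.
Qed.

Lemma finite_rank_le (T : Type) (A : set T) (f : T -> nat) (n : nat) :
  {in A &, injective f} -> finite_set [set x | A x /\ (f x <= n)%N].
Proof.
move=> finj; have ginj : {in [set x | A x /\ (f x <= n)%N] &, injective f}.
  by move=> x y /set_mem[Ax _] /set_mem[Ay _]; apply: finj; apply: mem_set.
rewrite -(eq_finite_set (inj_card_eq ginj)).
by apply: sub_finite_set (finite_II n.+1) => _ [x [_ fx] <-].
Qed.

(** An injection of [A] into the naturals codes finite subsets of [A] by finite sets of naturals, of
    which there are countably many. *)
Lemma countable_fsets (T : choiceType) (A : set T) : countable A ->
  countable [set p : {fset T} | [set` p] `<=` A].
Proof.
move=> /countable_injP[f finj]; apply/countable_injP.
exists (fun p : {fset T} => choice.pickle [fset f x | x in p]%fset).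
suff sub (p q : {fset T}) : [set` p] `<=` A -> [set` q] `<=` A ->
    [fset f x | x in p]%fset = [fset f x | x in q]%fset -> {subset p <= q}.
  move=> p q /set_mem/= pA /set_mem/= qA /(pcan_inj choice.pickleK) fpq.
  by apply/fsetP => x; apply/idP/idP; apply: sub.
move=> pA qA fpq x xp.
have : f x \in [fset f x | x in p]%fset by apply: in_imfset.
rewrite fpq => /imfsetP[y /= yq] /finj -> //; apply: mem_set.
  exact: pA.
exact: qA.
Qed.

Lemma uncountable_fiber (T U : Type) (A : set T) (B : set U) (f : T -> U) :
  ~ countable A -> countable B -> (forall x, A x -> B (f x)) ->
  exists u, ~ countable (A `&` [set x | f x = u]).
Proof.
move=> ncA cB AB; apply: contrapT => /forallNP cF; apply: ncA.
have cU : countable (\bigcup_(u in B) (A `&` [set x | f x = u])).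
  by apply: bigcup_countable => // u _; apply: contrapT; exact: cF.
apply: sub_countable cU; apply: subset_card_le => x Ax.
by exists (f x); [exact: AB|].
Qed.

(** * Closure points, clubs and ladders on the first uncountable ordinal *)

Section Omega1.
Context (d : Order.disp_t) (W : orderType d) (W1 : is_omega1 W).
Implicit Types (A T : set W) (g : W -> W) (a b : W).

Lemma least_element A : A !=set0 -> exists2 m, A m & lbound A m.
Proof. by case: W1 => + _ _; apply. Qed.

Lemma countable_segment a : countable (segment a).
Proof. by case: W1. Qed.

Lemma countable_le a : countable [set x | x <= a].
Proof.
have /countable_injP[f finj] := countable_segment a.
apply/countable_injP.
(* The shift by one frees the code 0 for [a]. *)
exists (fun x => if x == a then 0%N else (f x).+1) => x y /set_mem/= + /set_mem/=.
rewrite !le_eqVlt.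
by have [->|_] := eqVneq x a; have [->|_] := eqVneq y a => //= xa ya [/finj];
  apply; apply: mem_set.
Qed.

Lemma countable_bounded A : countable A -> exists b, forall x, A x -> x < b.
Proof.
move=> cA; apply: contrapT => /forallNP nb; case: W1 => _ + _; apply.
have cU : countable (\bigcup_(x in A) [set y | y <= x]).
  by apply: bigcup_countable => // x _; exact: countable_le.
apply: sub_countable cU; apply: subset_card_le => y _.
have /existsNP[x /not_implyP[Ax /negP]] := nb y.
by rewrite -leNgt => yx; exists x.
Qed.

Lemma uncountable_unbounded A : ~ countable A -> unbounded A.
Proof.
move=> ncA a; apply: contrapT => nA; apply: ncA.
apply: sub_countable (countable_le a); apply: subset_card_le => y Ay /=.
by rewrite leNgt; apply/negP => ay; apply: nA; exists y.
Qed.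

Lemma unbounded_uncountable A : unbounded A -> ~ countable A.
Proof.
move=> uA /countable_bounded[b Ab]; have [c /Ab cb bc] := uA b.
by move: (lt_trans cb bc); rewrite ltxx.
Qed.

Definition closed_under g a := forall x, x < a -> g x < a.

(** The least strict upper bound of [a], [h a], [h (h a)], ... is a closure point when [h x] exceeds
    [x] and every [g y] with [y <= x]. *)
Lemma closed_under_unbounded g : unbounded (closed_under g).
Proof.
move=> a.
have /choice[h hP] : forall x, exists b, x < b /\ forall y, y <= x -> g y < b.
  move=> x.
  have [b bP] := countable_bounded (countable_le x).
  have [|c cP] := @countable_bounded [set g y | y in [set y | y <= x]].
    by exact: sub_countable (card_image_le _ _) (countable_le x).
  exists (Order.max b c); split=> [|y yx]; rewrite lt_max.
    by rewrite bP /=.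
  by rewrite [g y < c]cP ?orbT //; exists y.
pose s n := iter n h a.
have [|m ms mlb] := @least_element [set b | forall n, s n < b].
  have [|b bP] := @countable_bounded (range s).
    exact: sub_countable (card_image_le _ _) (countableP _).
  by exists b => n; apply: bP; exists n.
exists m; last exact: ms 0%N.
move=> x xm.
have /existsNP[n /negP] : ~ forall n, s n < x.
  by move=> /mlb; rewrite leNgt xm.
rewrite -leNgt => xn; have [_ /(_ _ xn) gx] := hP (s n).
exact: lt_trans gx (ms n.+1).
Qed.

(* Fodor's lemma for functions regressive on closure points, with
   "unboundedly many" in place of "stationarily many". *)
Lemma pressing_down g (phi : W -> W) a0 : (forall a, a0 < a -> phi a < a) ->
  exists b, unbounded [set a | closed_under g a /\ phi a <= b].
Proof.
move=> phi_lt; apply: contrapT => /forallNP nb.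
have /choice[h hP] : forall b, exists c, forall a, c < a ->
    closed_under g a -> b < phi a.
  move=> b; have /existsNP[c cP] := nb b; exists c => a ca ga.
  by rewrite ltNge; apply/negP => ab; apply: cP; exists a.
(* At a point [a] closed under [h] too, [phi a < a] gives [h (phi a) < a], and the choice of [h]
   then yields [phi a < phi a]. *)
have [a ca a0a] := closed_under_unbounded (fun x => Order.max (g x) (h x)) a0.
have cg : closed_under g a.
  by move=> x /ca; rewrite gt_max => /andP[].
have /ca := phi_lt _ a0a; rewrite gt_max => /andP[_ ha].
by have := hP _ _ ha cg; rewrite ltxx.
Qed.

Definition cofinal_in A a := forall b, b < a -> exists2 c, A c & b < c < a.

Lemma stationary_unbounded T : stationary T -> unbounded T.
Proof.
move=> sT a; have [|x [Tx ax]] := sT [set x | a < x]; last by exists x.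
split=> [b [c cb] /(_ c cb)[x /= ax /andP[_ xb]]|b /=].
  exact: lt_trans ax xb.
(* [id] is a dummy: only a point above both [a] and [b] is wanted. *)
have [c _] := closed_under_unbounded id (Order.max a b).
by rewrite gt_max => /andP[]; exists c.
Qed.

Lemma club_limits (D T : set W) : club D -> unbounded T ->
  club (D `&` [set a | segment a !=set0 /\ cofinal_in T a]).
Proof.
move=> [Dcl Dun] Tun; split=> [a a0 aP|a].
  split; first by apply: Dcl => // b /aP[c [Dc _] bca]; exists c.
  split=> // b /aP[c [_ [_ cT]] /andP[bc ca]].
  have [t Tt /andP[bt tc]] := cT _ bc.
  by exists t => //; rewrite bt (lt_trans tc ca).
have /choice[f fP] : forall x, exists y, D y /\ x < y.
  by move=> x; have [y] := Dun x; exists y.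
have /choice[g gP] : forall x, exists y, T y /\ x < y.
  by move=> x; have [y] := Tun x; exists y.
(* Closure under both selectors makes [b] a limit of [D] and of [T]. *)
have [b cb ab] := closed_under_unbounded (fun x => Order.max (f x) (g x)) a.
have b0 : segment b !=set0 by exists a.
exists b => //; split.
  apply: Dcl => // x /cb; rewrite gt_max => /andP[fb _].
  by have [Df xf] := fP x; exists (f x); rewrite ?xf.
split=> // x /cb; rewrite gt_max => /andP[_ gb].
by have [Tg xg] := gP x; exists (g x); rewrite ?xg.
Qed.

(** Each [C b] is finite, or cofinal in [b] of order type omega. *)
Definition locally_finite (C : W -> set W) : Prop :=
  forall b, C b `<=` segment b /\
    forall a, a < b -> finite_set (C b `&` segment a).

(** Number the points below [b] by [f] and the sets in [S b] by [g]. From each cofinal [A] pick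
    [c A] above all [x < b] with [f x <= g A]. Then [c A < a] forces [g A < f a], so only finitely
    many picks lie below [a]. *)
Lemma ladder_meeting (S : W -> set (set W)) : (forall b, countable (S b)) ->
  exists2 C : W -> set W, locally_finite C &
    forall b A, S b A -> segment b !=set0 -> cofinal_in A b -> C b `&` A !=set0.
Proof.
move=> cS.
suff /choice[C CP] : forall b, exists C : set W,
    (C `<=` segment b /\ forall a, a < b -> finite_set (C `&` segment a)) /\
    (forall A, S b A -> segment b !=set0 -> cofinal_in A b -> C `&` A !=set0).
  by exists C => b; [exact: (CP b).1|exact: (CP b).2].
move=> b.
have [[c0 c0b]|b0] := pselect (segment b !=set0); last first.
  by exists set0; split=> //; split=> // a _; rewrite set0I.
have /countable_injP[f finj] := countable_segment b.
have /countable_injP[g ginj] := cS b.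
have /choice[c cP] : forall A, exists c, S b A -> cofinal_in A b ->
    [/\ A c, c < b & forall x, x < b -> (f x <= g A)%N -> x < c].
  move=> A; have [SA|nSA] := pselect (S b A /\ cofinal_in A b); last first.
    (* Junk value for an [A] that is not guessed or not cofinal. *)
    by exists b => SA Ab; case: nSA.
  have [||m mb mub] :=
      @finite_lt_bound _ _ [set x | x < b /\ (f x <= g A)%N] _ b _ c0b.
  - exact: finite_rank_le.
  - by move=> x [].
  have [c Ac /andP[mc cb]] := SA.2 _ mb.
  exists c => _ _; split=> // x xb fx.
  by apply: le_lt_trans mc; apply: mub.
exists [set c A | A in [set A | S b A /\ cofinal_in A b]]; split; last first.
  move=> A SA _ Ab; exists (c A); split; first by exists A.
  by have [] := cP _ SA Ab.
split=> [_ [A [SA Ab] <-]|a ab]; first by have [] := cP _ SA Ab.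
have fin : finite_set [set A | S b A /\ (g A <= f a)%N] by exact: finite_rank_le.
apply: sub_finite_set (finite_image c fin) => _ [[A [SA Ab] <-] /= cAa].
exists A => //; split=> //; rewrite leqNgt; apply/negP => /ltnW fag.
by have [_ _ /(_ a ab fag)/(lt_trans cAa)] := cP _ SA Ab; rewrite ltxx.
Qed.

End Omega1.

(** * The poset of free sets under reverse inclusion *)

Section FreeSets.
Context (d : Order.disp_t) (W : orderType d) (C : W -> set W).

(** Independence in the graph joining each [y] to the points of [C y]; boolean, so that equality in
    the subtype is equality of finite sets. *)
Definition free (p : {fset W}) : bool :=
  `[< forall x y, x \in p -> y \in p -> ~ C y x >].

Definition free_set : Type := {p : {fset W} | free p}.

Let le (p q : free_set) : bool := (val q `<=` val p)%fset.

Let le_refl : reflexive le.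
Proof. by move=> p; exact: fsubset_refl. Qed.

Let le_anti : antisymmetric le.
Proof. by move=> p q pq; apply: val_inj; apply/eqP; rewrite eqEfsubset andbC. Qed.

Let le_trans : transitive le.
Proof. by move=> q p r qp rq; exact: fsubset_trans rq qp. Qed.

HB.instance Definition _ := Choice.on free_set.
HB.instance Definition _ :=
  Order.Le_isPOrder.Build Order.default_display free_set
    le_refl le_anti le_trans.

Lemma free_set_leE (p q : free_set) : (p <= q) = (val q `<=` val p)%fset.
Proof. by []. Qed.

Lemma free_set_compatible (p q : free_set) :
  free (val p `|` val q)%fset -> compatible p q.
Proof.
move=> pq; exists (exist (fun s => free s) _ pq : free_set).
by rewrite !free_set_leE /=; split; [exact: fsubsetUl|exact: fsubsetUr].
Qed.

End FreeSets.

(** * The Knaster property and the failure of its stationary form *)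

Section Knaster.
Context (d : Order.disp_t) (W : orderType d) (W1 : is_omega1 W).
Context (C : W -> set W) (C_lf : locally_finite C).

(* Otherwise the exceptional points are cofinal in some [b], and all those below
   [b] belong to the finite set [p b]. *)
Lemma almost_always_avoided (p : W -> {fset W}) :
  exists a0, forall a, a0 < a -> exists i, a <= i /\ a \notin p i.
Proof.
pose R := [set a | forall i, a <= i -> a \in p i].
have [w _] : [set: W] !=set0.
  by apply/set0P/eqP => W0; case: W1 => _; rewrite W0 => /(_ (countable0 _)).
apply: contrapT => /forallNP nR.
have Run : unbounded R.
  move=> a; have /existsNP[b /not_implyP[ab bR]] := nR a; exists b => // i bi.
  by apply: contrapT => /negP ip; apply: bR; exists i.
have clubT : club [set: W].
  split=> // a; have [b] := Run a; by exists b.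
have [b [_ [[x xb] Rb]] _] := (club_limits W1 clubT Run).2 w.
have [||c cb cub] := @finite_lt_bound _ _ (R `&` segment b) x b _ xb.
- apply: sub_finite_set (finite_fset (p b)) => y [/= Ry yb].
  exact: Ry (ltW yb).
- by move=> y [].
have [y Ry /andP[cy yb]] := Rb _ cb.
by have := cub y (conj Ry yb); rewrite leNgt cy.
Qed.

Lemma free_sets_Knaster : Knaster (free_set C) W.
Proof.
move=> p.
have [a0 a0P] := almost_always_avoided (fun i => val (p i)).
have /choice[h hP] : forall a, exists i, a0 < a -> a <= i /\ a \notin val (p i).
  move=> a; have [/a0P[i iP]|a0a] := boolP (a0 < a); first by exists i.
  by exists a.
(* For [b] closed under [g] and [a < b], all of [p (h a)] lies below [b]. *)
have /choice[g gP] : forall a, exists b, forall x, x \in val (p (h a)) -> x < b.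
  move=> a; apply: (@countable_bounded _ _ W1 [set` val (p (h a))]).
  exact: finite_set_countable (finite_fset _).
pose F a := [set x | x < a /\ (x \in val (p (h a)) \/
  exists y, [/\ y \in val (p (h a)), a < y & C y x])].
have finF a : finite_set (F a).
  have fin2 : finite_set (\bigcup_(y in [set y | y \in val (p (h a)) /\ a < y])
      (C y `&` segment a)).
    apply: bigcup_finite => [|y [_ ay]]; last exact: (C_lf y).2.
    by apply: sub_finite_set (finite_fset (val (p (h a)))) => y [].
  have finU : finite_set ([set` val (p (h a))] `|`
      \bigcup_(y in [set y | y \in val (p (h a)) /\ a < y]) (C y `&` segment a)).
    by rewrite finite_setU; split.
  apply: sub_finite_set finU => x [xa [xp|[y [yp ay yx]]]]; first by left.
  by right; exists y.
have /choice[phi phiP] : forall a, exists b, a0 < a ->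
    b < a /\ forall x, F a x -> x <= b.
  move=> a; have [a0a|] := boolP (a0 < a); last by exists a.
  have [|b ba bub] := finite_lt_bound (finF a) a0a; first by move=> x [].
  by exists b.
have [m munb] := pressing_down W1 g (fun a a0a => (phiP a a0a).1).
pose E := [set a | [/\ a0 < a, m < a, closed_under g a & phi a <= m]].
have Eunc : ~ countable E.
  apply: (unbounded_uncountable W1) => a.
  have [b [gb phib]] := munb (Order.max a (Order.max a0 m)).
  by rewrite !gt_max => /and3P[ab a0b mb]; exists b.
pose trace a : {fset W} := [fset x in val (p (h a)) | x < a]%fset.
(* On [E] the trace is a finite set of points [<= m], so it takes countably many values. *)
have [|r rP] := @uncountable_fiber _ _ _ _ trace Eunc
    (countable_fsets (countable_le W1 m)).
  move=> a [a0a ma _ phia] x /=; rewrite !inE => /andP[xp xa].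
  apply: le_trans phia; apply: (phiP a a0a).2; split=> //; by left.
exists (h @` (E `&` [set a | trace a = r])).
  (* [h] need not be injective, but [b <= h b] keeps the image unbounded. *)
  apply: (unbounded_uncountable W1) => a.
  have [b Eb ab] := uncountable_unbounded W1 rP a.
  exists (h b); first by exists b.
  by have [[/hP[bh _] _ _ _] _] := Eb; exact: lt_le_trans ab bh.
have union_free a b : E a -> E b -> trace a = r -> trace b = r -> a < b ->
    free C (val (p (h a)) `|` val (p (h b)))%fset.
  move=> [a0a ma _ _] [a0b mb gb phib] ta tb ab; apply/asboolP.
  have /asboolP pa := valP (p (h a)); have /asboolP pb := valP (p (h b)).
  have below x : x \in val (p (h a)) -> x < b.
    by move=> /(gP a) xg; exact: lt_trans xg (gb _ ab).
  have b_to_a x : x \in val (p (h b)) -> x < b -> x \in val (p (h a)).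
    move=> xp xb; have : x \in trace b by rewrite !inE xp.
    by rewrite tb -ta !inE => /andP[].
  have a_to_b x : x \in val (p (h a)) -> x < a -> x \in val (p (h b)).
    move=> xp xa; have : x \in trace a by rewrite !inE xp.
    by rewrite ta -tb !inE => /andP[].
  move=> x y; rewrite !inE => /orP[xp|xp] /orP[yp|yp] Cyx.
  - exact: pa xp yp Cyx.
  - have [yb|by_] := ltP y b; first exact: pa xp (b_to_a _ yp yb) Cyx.
    (* [y] is not [b], since [b] is not in [p (h b)]; hence [x] is in [F b]. *)
    have {by_} lt_by : b < y.
      rewrite lt_neqAle by_ andbT; apply/eqP => bE.
      by have [_] := hP _ a0b; rewrite {1}bE yp.
    (* [x <= phi b <= m < a] puts [x] in the common trace, hence in [p (h b)]. *)
    have xa : x < a.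
      apply: le_lt_trans ma; apply: le_trans phib; apply: (phiP b a0b).2.
      by split; [exact: below|right; exists y].
    exact: pb (a_to_b _ xp xa) yp Cyx.
  (* Here [x < y < b] already puts [x] in the common trace. *)
  - have xy : x < y by exact: (C_lf y).1.
    exact: pa (b_to_a _ xp (lt_trans xy (below _ yp))) yp Cyx.
  - exact: pb xp yp Cyx.
move=> _ _ [_ [a [Ea ta] <-] <-] [_ [b [Eb tb] <-] <-].
have [ab|ba|->] := ltgtP a b.
- exact: free_set_compatible (union_free _ _ Ea Eb ta tb ab).
- by apply: free_set_compatible; rewrite fsetUC; exact: union_free.
- by exists (p (h b)).
Qed.

Lemma free_singleton a : free C [fset a]%fset.
Proof.
apply/asboolP => x y; rewrite !inE => /eqP-> /eqP-> /((C_lf a).1 _).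
by rewrite /segment /= ltxx.
Qed.

(** The family is that of all singletons: a common extension of those of [x] and [y] contains both
    points, so it is not free when [x] is in [C y]. *)
Lemma free_sets_not_stationarily_Knaster :
  (forall T, stationary T -> exists x y, [/\ T x, T y & C y x]) ->
  ~ stationarily_Knaster (free_set C) W.
Proof.
move=> hit.
pose p a : free_set C := exist (fun s => free C s) _ (free_singleton a).
have st : stationary [set: W].
  move=> D [_ Dun]; rewrite setTI.
  (* This only supplies a point of [W], above which [D] has an element. *)
  have [a0 _] := almost_always_avoided (fun=> fset0).
  by have [c] := Dun a0; exists c.
move=> /(_ _ p st)[T [_ /hit[x [y [Tx Ty Cyx]]]]].
move=> /(_ (p x) (p y)) [||r []]; [by exists x|by exists y|].
rewrite !free_set_leE !fsub1set => xr yr.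
by have /asboolP/(_ x y xr yr) := valP r.
Qed.

End Knaster.

Theorem theorem5p1 (d : Order.disp_t) (W : orderType d) (W_omega1 : is_omega1 W) :
  diamond_star W ->
  exists (e : Order.disp_t) (P : porderType e),
    Knaster P W /\ ~ stationarily_Knaster P W.
Proof.
move=> [S [SP guess]].
have [C C_lf C_hit] := ladder_meeting W_omega1 (fun b => (SP b).1).
exists Order.default_display, (free_set C); split.
  exact: free_sets_Knaster.
apply: free_sets_not_stationarily_Knaster => // T sT.
have [D Dclub DT] := guess T.
(* [y] is a point of [T], a limit of [T], and [T] is guessed at it, so [C y] meets [T] below [y]. *)
have [y [Ty [Dy [y0 Ty_cof]]]] :=
  sT _ (club_limits W_omega1 Dclub (stationary_unbounded W_omega1 sT)).
have [|x [Cyx [Tx _]]] := C_hit y _ (DT _ Dy) y0.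
  by move=> b /Ty_cof[c Tc /andP[bc cy]]; exists c; [split|rewrite bc].
by exists x, y.
Qed.
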